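(* If $G$ is a $d$-degenerate finite simple graph, then $\textup{ch}_\Sigma^v(G) \leq d\Delta(G) + 1$.
   Context: $\Delta(G)$ is the maximum degree of $G$. A graph is $d$-degenerate if every subgraph has a vertex of degree at most $d$. Given an assignment to each vertex $v$ of a list $L_v$ of real numbers, a vertex list-weighting is a function $w$ with $w(v)\in L_v$ for all $v$; it is an additive colouring (proper vertex colouring by sums) if $\sum_{x\in N_G(u)} w(x) \neq \sum_{x\in N_G(v)} w(x)$ for every edge $uv\in E(G)$, where $N_G(\cdot)$ is the open neighbourhood. The additive choosability number $\textup{ch}_\Sigma^v(G)$ is the smallest $k$ such that for every assignment of lists of size $k$ of real numbers to the vertices of $G$, there is a vertex list-weighting from these lists which is an additive colouring. *)

(* Defs.v *)
From mathcomp Require Import all_boot all_order all_algebra finmap.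
From mathcomp Require Import boolp reals.

Set Implicit Arguments.
Unset Strict Implicit.
Unset Printing Implicit Defensive.

Import Order.TTheory GRing.Theory Num.Theory.

Local Open Scope ring_scope.

Record sgraph := SGraph {
  vertex :> finType;
  adj : rel vertex;
  adj_sym : symmetric adj;
  adj_irrefl : irreflexive adj
}.

Definition nbhd (G : sgraph) (v : G) : {set G} := [set x | adj v x].

Definition max_degree (G : sgraph) : nat := (\max_(v : G) #|nbhd v|)%N.

(* The subgraph with vertex set S and edge relation f; it need not be
   induced. *)
Definition is_subgraph (G : sgraph) (S : {set G}) (f : rel G) : Prop :=
  symmetric f /\
  (forall x y : G, f x y -> [/\ x \in S, y \in S & adj x y]).

(* Only nonempty subgraphs are considered: the null graph has no vertex. *)
Definition degenerate (d : nat) (G : sgraph) : Prop :=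
  forall (S : {set G}) (f : rel G), is_subgraph S f -> S != set0 ->
  exists2 v : G, v \in S & (#|[set x | f v x]| <= d)%N.

Definition additive_colouring (R : realType) (G : sgraph) (w : G -> R) : Prop :=
  forall u v : G, adj u v ->
  \sum_(x in nbhd u) w x <> \sum_(x in nbhd v) w x.

Definition list_weighting (R : realType) (G : sgraph) (L : G -> {fset R})
    (w : G -> R) : Prop :=
  forall v : G, w v \in L v.

Definition additively_choosable (R : realType) (G : sgraph) (k : nat) : Prop :=
  forall L : G -> {fset R}, (forall v : G, #|` L v| = k) ->
  exists w : G -> R, list_weighting L w /\ additive_colouring w.

(* Some list size always suffices, so that the minimum below exists. Weights
   are chosen greedily: each edge excludes at most one value at the vertex
   where the difference of the two sums becomes determined. *)
Lemma additively_choosable_ex (R : realType) (G : sgraph) :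
  exists k : nat, `[< additively_choosable R G k >].
Proof.
exists #|{: G * G}|.+1; apply/asboolP => L sL.
pose c (p : G * G) (x : G) : R :=
  (x \in nbhd p.1)%:R - (x \in nbhd p.2)%:R.
have cE (p : G * G) (w : G -> R) :
    \sum_x c p x * w x = \sum_(x in nbhd p.1) w x - \sum_(x in nbhd p.2) w x.
  rewrite [X in X - _]big_mkcond [X in _ - X]big_mkcond -sumrB.
  apply: eq_bigr => x _; rewrite /c.
  by do 2![case: (_ \in _)];
    rewrite ?subrr ?subr0 ?sub0r ?mul0r ?mul1r ?mulN1r.
have greedy (s : seq G) : exists2 w : G -> R, list_weighting L w &
    forall p : G * G, (exists2 x, x \in s & c p x != 0) ->
      (forall x, x \notin s -> c p x = 0) -> \sum_x c p x * w x != 0.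
  elim: s => [|a s [w Lw IHw]].
    have /choice[w Lw] (v : G) : exists r, r \in L v.
      by apply/fset0Pn; rewrite -cardfs_gt0 sL.
    by exists w => // p [].
  pose bad (p : G * G) : R := - (\sum_(x | x != a) c p x * w x) / c p a.
  pose B : {fset R} := [fset r | r in [seq bad p | p : G * G]]%fset.
  have [r rL rB] : exists2 r, r \in L a & r \notin B.
    apply/fsubsetPn; apply/negP => /fsubset_leq_card.
    rewrite sL; apply/negP; rewrite -ltnNge ltnS.
    rewrite (leq_trans (leq_imfset_card _ _ _)) //=.
    by rewrite (leq_trans (size_undup _)) // size_map cardE.
  exists (fun x => if x == a then r else w x) => [v|p [x xs cx] cN].
    by case: eqVneq => [->|].
  have [ca0|ca] := eqVneq (c p a) 0.
    suff -> : \sum_y c p y * (if y == a then r else w y)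
            = \sum_y c p y * w y.
      apply: IHw => [|y ys].
        exists x => //; move: xs; rewrite inE => /predU1P[xa|//].
        by rewrite xa ca0 eqxx in cx.
      by have [->//|ya] := eqVneq y a; apply: cN; rewrite inE negb_or ya.
    by apply: eq_bigr => y _; case: eqVneq => // ->; rewrite ca0 !mul0r.
  rewrite (bigD1 a) //= eqxx.
  under eq_bigr => y /negPf-> do [].
  apply: contra rB => /eqP/addr0_eq E.
  rewrite inE /=; apply/mapP; exists p; first by rewrite mem_enum.
  by rewrite /bad -E opprK mulrAC mulfV // mul1r.
have [w Lw Hw] := greedy (enum G).
exists w; split=> // u v uv /eqP; apply/negP.
rewrite -subr_eq0 -(cE (u, v)); apply: Hw => [|x]; last by rewrite mem_enum.
exists v; first by rewrite mem_enum.
by rewrite /c !inE /= uv adj_irrefl subr0 oner_eq0.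
Qed.

Definition additive_choosability (R : realType) (G : sgraph) : nat :=
  ex_minn (additively_choosable_ex R G).

(* Main.v *)
(** Remove vertices one at a time, each having at most [d] neighbours among
    the vertices still present, and choose the weights in the reverse order.
    When [a] receives its weight, let [S] be the set of weighted vertices,
    [a] included. The difference of the sums at the ends of an edge [uz] is
    settled at that moment only if [a] lies in the symmetric difference of
    [N(u)] and [N(z)], itself contained in [S]; say [a] is in [N(u)]. As [u] is
    in [N(z)] but not in [N(u)], it belongs to [S]. So there are at most [d]
    choices for [u], then at most [Delta(G)] for [z], and each such edge
    excludes one weight for [a]. *)
Require Import Defs.
From mathcomp Require Import all_boot all_order all_algebra finmap.
From mathcomp Require Import boolp reals.

Import GRing.Theory.

Local Open Scope ring_scope.

Lemma degenerate_induced {d : nat} {G : sgraph} (S : {set G}) :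
  degenerate d G -> S != set0 ->
  exists2 a : G, a \in S & (#|S :&: nbhd a| <= d)%N.
Proof.
move=> dG S0; pose f (x y : G) := [&& x \in S, y \in S & adj x y].
have [|a aS le_d] := dG S f _ S0.
  split=> [x y|x y /and3P[]//]; rewrite /f adj_sym.
  by case: (x \in S); case: (y \in S).
exists a => //; apply: leq_trans le_d; apply/subset_leq_card/subsetP => x.
by rewrite !inE /f aS.
Qed.

Lemma leq_degree {G : sgraph} (v : G) : (#|nbhd v| <= max_degree G)%N.
Proof. exact: (leq_bigmax (F := fun v : G => #|nbhd v|)). Qed.

(** Induction on [S]: the guarantee is limited to edges whose end neighbourhoods agree outside [S],
    so for [S = setT] it covers every edge. *)
Lemma greedy_weighting {R : realType} {G : sgraph} {d : nat}
    (L : G -> {fset R}) (S : {set G}) :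
  degenerate d G -> (forall v, d * max_degree G < #|` L v|)%N ->
  exists2 w : G -> R, list_weighting L w &
    forall u z : G, adj u z -> (forall x, adj u x != adj z x -> x \in S) ->
      \sum_(x in nbhd u) w x != \sum_(x in nbhd z) w x.
Proof.
move=> dG sL; have [n] := ubnP #|S|; elim: n S => // n IHn S leSn.
have [->|S0] := eqVneq S set0.
  have /choice[w Lw] (v : G) : exists r, r \in L v.
    by apply/fset0Pn; rewrite -cardfs_gt0 (leq_ltn_trans _ (sL v)).
  (* No edge qualifies: [u] lies in the neighbourhood of [z] but not in its own. *)
  exists w => // u z uz /(_ u).
  by rewrite adj_irrefl adj_sym uz inE => /(_ isT).
have [a aS le_d] := degenerate_induced S dG S0.
have [|w Lw IHw] := IHn (S :\ a).
  by move: leSn; rewrite (cardsD1 a S) aS.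
(* When [a] is adjacent to [u] but not to [z], this is the only weight of [a] that makes the two
   sums equal. *)
pose bad u z := \sum_(x in nbhd z) w x - \sum_(x in nbhd u | x != a) w x.
pose s := [seq bad u z | u <- enum (S :&: nbhd a), z <- enum (nbhd u)].
have size_s : (size s <= d * max_degree G)%N.
  rewrite size_allpairs_dep sumnE big_map big_enum /=.
  apply: leq_trans (_ : #|S :&: nbhd a| * max_degree G <= _)%N.
    rewrite -sum_nat_const; apply: leq_sum => u _.
    by rewrite -cardE leq_degree.
  by rewrite leq_mul2r le_d orbT.
have [r rL rs] : exists2 r, r \in L a & r \notin s.
  have /fsubsetPn[r rL] : ~~ (L a `<=` [fset r in s])%fset.
    apply/negP => /fsubset_leq_card; apply/negP; rewrite -ltnNge.
    apply: leq_ltn_trans (sL a); apply: leq_trans size_s.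
    by rewrite card_fseq size_undup.
  by rewrite inE; exists r.
pose w' x := if x == a then r else w x.
have sum_w' v : \sum_(x in nbhd v | x != a) w' x
              = \sum_(x in nbhd v | x != a) w x.
  by apply: eq_bigr => x /andP[_ /negPf xa]; rewrite /w' xa.
have sumN v : ~~ adj v a -> \sum_(x in nbhd v) w' x = \sum_(x in nbhd v) w x.
  move=> va; apply: eq_bigr => x; rewrite /w' inE.
  by have [->|//] := eqVneq x a; rewrite (negPf va).
have sumD1 v (f : G -> R) : adj v a -> \sum_(x in nbhd v) f x
    = f a + \sum_(x in nbhd v | x != a) f x.
  by move=> va; rewrite (bigD1 a) ?inE.
exists w' => [v|]; first by rewrite /w'; case: eqVneq => [->|].
have key u z : adj u z -> (forall x, adj u x != adj z x -> x \in S) ->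
    adj u a -> ~~ adj z a ->
    \sum_(x in nbhd u) w' x != \sum_(x in nbhd z) w' x.
  move=> uz uzS ua za; rewrite sumD1 // sum_w' (sumN z) // {1}/w' eqxx.
  apply: contra rs => /eqP E; apply/allpairsPdep; exists u, z.
  rewrite !mem_enum !inE uz (adj_sym a) ua andbT.
  split; [|by []|by rewrite /bad -E addrK].
  by apply: uzS; rewrite adj_irrefl adj_sym uz.
move=> u z uz uzS.
(* If [a] does not separate [u] from [z], the edge is already handled at [S :\ a]: the new weight
   shifts both sums equally or neither. *)
have uzSD : adj u a = adj z a ->
    forall x, adj u x != adj z x -> x \in S :\ a.
  move=> E x xuz; rewrite !inE uzS // andbT.
  by apply: contraNneq xuz => ->; rewrite E.
case ua: (adj u a) uzSD; case za: (adj z a) => uzSD.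
- move: (IHw _ _ uz (uzSD erefl)).
  by rewrite !sumD1 // !sum_w' !(inj_eq (addrI _)).
- by apply: key; rewrite ?ua ?za.
- rewrite eq_sym; apply: key; rewrite ?ua ?za ?(adj_sym z) //.
  by move=> x; rewrite eq_sym; apply: uzS.
- by rewrite !sumN ?ua ?za //; apply: IHw => //; apply: uzSD.
Qed.

Theorem theorem5p10 (R : realType) (G : sgraph) (d : nat) :
  degenerate d G ->
  (additive_choosability R G <= d * max_degree G + 1)%N.
Proof.
move=> dG; rewrite /additive_choosability; case: ex_minnP => k _; apply.
apply/asboolP => L sL.
have [|w Lw Hw] := greedy_weighting L setT dG; first by move=> v; rewrite sL addn1.
by exists w; split=> // u v uv; apply/eqP/Hw.
Qed.
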